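(* Let $\mathcal{C}$ be a strict Fraïssé class with Fraïssé limit $\mathbf{U}$ such that (1) $\mathcal{C}$ is closed under finite products, (2) $\mathcal{C}$ has the HAP, (3) the coproduct of $\aleph_0$ copies of $\mathbf{U}$ exists in the category of structures in $\overline{\mathcal{C}}$ with all homomorphisms, (4) $\operatorname{End}\mathbf{U}$ is not finitely generated (as a monoid). Then $\operatorname{Pol}\mathbf{U}$ has uncountable cofinality.
   Context: An embedding is an injective homomorphism reflecting all relations. An age is a class of finitely generated structures of one signature with countably many isomorphism types, closed under finitely generated substructures (up to isomorphism) and with the joint embedding property; $\overline{\mathcal{C}}$ is the class of countable structures all of whose finitely generated substructures are isomorphic to members of $\mathcal{C}$; a Fraïssé class is an age with the amalgamation property, with Fraïssé limit the unique countable homogeneous structure of that age. A Fraïssé class $\mathcal{C}$ is strict if for all $\mathbf{A},\mathbf{B}_1,\mathbf{B}_2\in\mathcal{C}$ and embeddings $f_i:\mathbf{A}\hookrightarrow\mathbf{B}_i$ there exist $\mathbf{C}\in\mathcal{C}$ and homomorphisms $g_i:\mathbf{B}_i\to\mathbf{C}$ forming a pushout of $f_1,f_2$ in the category of structures in $\overline{\mathcal{C}}$ with homomorphisms. HAP: for every embedding $f_1:\mathbf{A}\hookrightarrow\mathbf{B}_1$ and homomorphism $f_2:\mathbf{A}\to\mathbf{B}_2$ in $\mathcal{C}$ there exist $\mathbf{C}\in\mathcal{C}$, an embedding $g_2:\mathbf{B}_2\hookrightarrow\mathbf{C}$ and a homomorphism $g_1:\mathbf{B}_1\to\mathbf{C}$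 with $g_1f_1=g_2f_2$. $\operatorname{Pol}\mathbf{U}$ is the clone (set of finitary operations closed under composition and containing projections) of all homomorphisms $\mathbf{U}^n\to\mathbf{U}$, $\operatorname{End}\mathbf{U}$ its unary part. The cofinality of a non-finitely generated clone is the least cardinal $\lambda$ such that it is the union of an increasing chain of length $\lambda$ of proper subclones. *)

(* Defs.v *)
From mathcomp Require Import all_boot.
From Stdlib Require List.
Set Implicit Arguments. Unset Strict Implicit. Unset Printing Implicit Defensive.

Record signature := Signature {
  fsym : Type; farity : fsym -> nat;
  rsym : Type; rarity : rsym -> nat }.

Record structure (S : signature) := Structure {
  carrier :> Type;
  fint : forall f : fsym S, ('I_(farity f) -> carrier) -> carrier;
  rint : forall r : rsym S, ('I_(rarity r) -> carrier) -> Prop }.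
Arguments fint {S} s f _.
Arguments rint {S} s r _.

Section Basic.
Variable S : signature.
Implicit Types A B : structure S.

Definition hom A B (h : A -> B) : Prop :=
  (forall f args, h (fint A f args) = fint B f (fun j => h (args j))) /\
  (forall r args, rint A r args -> rint B r (fun j => h (args j))).

Definition emb A B (h : A -> B) : Prop :=
  hom h /\ (forall x y, h x = h y -> x = y) /\
  (forall r args, rint B r (fun j => h (args j)) -> rint A r args).

Definition surj A B (h : A -> B) : Prop := forall y, exists x, h x = y.

Definition iso A B : Prop := exists h : A -> B, emb h /\ surj h.

Definition countable A : Prop := exists c : A -> nat, forall x y, c x = c y -> x = y.

Definition closed A (P : A -> Prop) : Prop :=
  forall f args, (forall j, P (args j)) -> P (fint A f args).

Definition gen A (s : list A) (y : A) : Prop :=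
  forall P, closed P -> (forall x, List.In x s -> P x) -> P y.

Lemma gen_closed A (s : list A) : closed (gen s).
Proof. rewrite /closed /gen.
move=> f args H P HP Hs; apply: (HP) => j; exact: (H j P HP Hs).
Qed.

Definition substr A (P : A -> Prop) (HP : closed P) : structure S :=
  {| carrier := {x : A | P x};
     fint := fun f args =>
       exist P (fint A f (fun j => proj1_sig (args j)))
             (HP f _ (fun j => proj2_sig (args j)));
     rint := fun r args => rint A r (fun j => proj1_sig (args j)) |}.

Definition fgsub A (s : list A) : structure S := substr (@gen_closed A s).

Definition fingen A : Prop := exists s : list A, forall y, gen s y.

Definition prodstr (I : Type) (F : I -> structure S) : structure S :=
  {| carrier := forall i, F i;
     fint := fun f args i => fint (F i) f (fun j => args j i);
     rint := fun r args => forall i, rint (F i) r (fun j => args j i) |}.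

Definition power A (n : nat) : structure S := prodstr (fun _ : 'I_n => A).

Variable C : structure S -> Prop.

Definition inCbar B : Prop :=
  countable B /\ forall s : list B, exists A, C A /\ iso A (fgsub s).

Definition is_age : Prop :=
  (forall A, C A -> fingen A) /\
  (exists enum : nat -> structure S, forall A, C A -> exists n, iso A (enum n)) /\
  (forall A, C A -> forall s : list A, exists B, C B /\ iso B (fgsub s)) /\
  (forall A B, C A -> C B ->
     exists D, C D /\ (exists e : A -> D, emb e) /\ (exists e : B -> D, emb e)).

Definition AP : Prop :=
  forall A B1 B2 (f1 : A -> B1) (f2 : A -> B2),
    C A -> C B1 -> C B2 -> emb f1 -> emb f2 ->
    exists (D : structure S) (g1 : B1 -> D) (g2 : B2 -> D),
      C D /\ emb g1 /\ emb g2 /\ forall a, g1 (f1 a) = g2 (f2 a).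

Definition fraisse_class : Prop := is_age /\ AP.

Definition is_pushout A B1 B2 (f1 : A -> B1) (f2 : A -> B2)
    (D : structure S) (g1 : B1 -> D) (g2 : B2 -> D) : Prop :=
  inCbar D /\ hom g1 /\ hom g2 /\ (forall a, g1 (f1 a) = g2 (f2 a)) /\
  forall (E : structure S) (h1 : B1 -> E) (h2 : B2 -> E),
    inCbar E -> hom h1 -> hom h2 -> (forall a, h1 (f1 a) = h2 (f2 a)) ->
    exists u : D -> E, hom u /\ (forall b, u (g1 b) = h1 b) /\
      (forall b, u (g2 b) = h2 b) /\
      forall u' : D -> E, hom u' -> (forall b, u' (g1 b) = h1 b) ->
        (forall b, u' (g2 b) = h2 b) -> forall x, u' x = u x.

Definition strict_fraisse_class : Prop :=
  fraisse_class /\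
  forall A B1 B2 (f1 : A -> B1) (f2 : A -> B2),
    C A -> C B1 -> C B2 -> emb f1 -> emb f2 ->
    exists (D : structure S) (g1 : B1 -> D) (g2 : B2 -> D), C D /\ is_pushout f1 f2 g1 g2.

Definition closed_fin_products : Prop :=
  forall n (F : 'I_n.+1 -> structure S), (forall i, C (F i)) ->
    exists B, C B /\ iso B (prodstr F).

Definition HAP : Prop :=
  forall A B1 B2 (f1 : A -> B1) (f2 : A -> B2),
    C A -> C B1 -> C B2 -> emb f1 -> hom f2 ->
    exists (D : structure S) (g1 : B1 -> D) (g2 : B2 -> D),
      C D /\ hom g1 /\ emb g2 /\ forall a, g1 (f1 a) = g2 (f2 a).

Definition homogeneous (U : structure S) : Prop :=
  forall (s t : list U) (phi : fgsub s -> fgsub t), emb phi -> surj phi ->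
    exists sigma : U -> U, emb sigma /\ surj sigma /\
      forall x, sigma (proj1_sig x) = proj1_sig (phi x).

Definition age_of_is (U : structure S) : Prop :=
  (forall s : list U, exists A, C A /\ iso A (fgsub s)) /\
  (forall A, C A -> exists e : A -> U, emb e).

Definition fraisse_limit (U : structure S) : Prop :=
  countable U /\ homogeneous U /\ age_of_is U.

Definition coproduct_omega_exists (U : structure S) : Prop :=
  exists (V : structure S) (iota : nat -> U -> V),
    inCbar V /\ (forall n, hom (iota n)) /\
    forall (E : structure S) (h : nat -> U -> E), inCbar E -> (forall n, hom (h n)) ->
      exists u : V -> E, hom u /\ (forall n x, u (iota n x) = h n x) /\
        forall u' : V -> E, hom u' -> (forall n x, u' (iota n x) = h n x) ->
          forall y, u' y = u y.

End Basic.

Definition End_fg (S : signature) (U : structure S) : Prop :=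
  exists gens : list (U -> U), (forall g, List.In g gens -> hom g) /\
    forall e : U -> U, hom e ->
      exists w : list (U -> U), (forall g, List.In g w -> List.In g gens) /\
        forall x, e x = List.fold_right (fun g h => fun y => g (h y)) id w x.

(** sets of finitary operations of positive arity on a carrier X
    (an operation of arity n.+1 is a map ('I_n.+1 -> X) -> X) *)
Definition opset (X : Type) := forall n : nat, (('I_n.+1 -> X) -> X) -> Prop.

Definition is_clone (X : Type) (Cl : opset X) : Prop :=
  (forall n (i : 'I_n.+1), Cl n (fun x => x i)) /\
  (forall n m (f : ('I_n.+1 -> X) -> X) (g : 'I_n.+1 -> ('I_m.+1 -> X) -> X),
     Cl n f -> (forall i, Cl m (g i)) -> Cl m (fun x => f (fun i => g i x))).

Definition opsubset (X : Type) (D E : opset X) : Prop :=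
  forall n f, D n f -> E n f.

Definition clone_gen (X : Type) (F : list {n : nat & ('I_n.+1 -> X) -> X}) : opset X :=
  fun n f => forall D : opset X, is_clone D ->
    (forall p, List.In p F -> D (projT1 p) (projT2 p)) -> D n f.

Definition clone_fg (X : Type) (Cl : opset X) : Prop :=
  exists F : list {n : nat & ('I_n.+1 -> X) -> X},
    (forall p, List.In p F -> Cl (projT1 p) (projT2 p)) /\
    opsubset Cl (clone_gen F).

Definition Pol (S : signature) (U : structure S) : opset U :=
  fun n f => @hom S (power U n.+1) U f.

(** uncountable cofinality: the clone is not finitely generated and is not the
    union of a countable (w.l.o.g. omega-indexed) increasing chain of proper
    subclones *)
Definition uncountable_cofinality (X : Type) (Cl : opset X) : Prop :=
  ~ clone_fg Cl /\
  ~ (exists Ch : nat -> opset X,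
       (forall k, is_clone (Ch k)) /\
       (forall k, opsubset (Ch k) Cl) /\
       (forall k, exists n f, Cl n f /\ ~ Ch k n f) /\
       (forall k, opsubset (Ch k) (Ch k.+1)) /\
       (forall n f, Cl n f -> exists k, Ch k n f)).

Arguments Pol {S} U _ _.
Arguments End_fg {S} U.
Arguments uncountable_cofinality {X} Cl.

(* Main.v *)
(* Call W injective when homomorphisms into W extend along embeddings of members
   of C; by HAP, U is injective, and so are its powers. The key fact is
   [hom_extension]: every T in the closure of C has a homomorphism j : T -> U along
   which every homomorphism from T to an injective W extends. Exhaust T by finitely
   generated A_n and U by finitely generated B_n, where B_(n+1) contains the pushout
   of A_(n+1) <- A_n -> B_n; a homomorphism on B_n and one on A_(n+1) then factor
   through the pushout, and injectivity of W carries them on to B_(n+1).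

   For T the coproduct of countably many copies of U, extending the copairing of a
   sequence f_k and the shift of the copies to F and Sh gives f_k = F Sh^k (j iota_0),
   so every sequence of endomorphisms lies in a finitely generated submonoid. For
   T = W = U^2, extending the identity gives p : U^2 -> U with a left inverse, hence
   Pol U is generated by End U and p. So in a countable chain of proper subclones with
   union Pol U, the unary parts are eventually proper, and a sequence of endomorphisms
   escaping them contradicts its finite generation. If Pol U were finitely generated it
   would be countable, and enumerating End U would make End U finitely generated. *)
Require Import Defs.
From mathcomp Require Import all_boot.
From Stdlib Require Import ClassicalEpsilon FunctionalExtensionality ProofIrrelevance.
Set Implicit Arguments. Unset Strict Implicit. Unset Printing Implicit Defensive.

Lemma fun_choice (I : Type) (X : I -> Type) (P : forall i, X i -> Prop) :
  (forall i, exists x, P i x) -> exists f : forall i, X i, forall i, P i (f i).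
Proof.
move=> H; exists (fun i => proj1_sig (constructive_indefinite_description _ (H i))) => i.
exact: proj2_sig (constructive_indefinite_description _ (H i)).
Qed.

Lemma dependent_choice (X : nat -> Type) (R : forall n, X n -> X n.+1 -> Prop) (x0 : X 0) :
  (forall n x, exists y, @R n x y) -> exists x : forall n, X n, forall n, R n (x n) (x n.+1).
Proof.
move=> H.
pose next n x := constructive_indefinite_description _ (H n x).
exists (nat_rect X x0 (fun n x => proj1_sig (next n x))) => n /=.
exact: proj2_sig (next n _).
Qed.

(** * Homomorphisms, embeddings and finitely generated substructures *)

Section Morphisms.
Context {S : signature}.
Implicit Types A B D : structure S.

Lemma emb_hom A B (f : A -> B) : emb f -> hom f.
Proof. by case. Qed.

Lemma hom_id A : hom (fun x : A => x).
Proof. by []. Qed.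

Lemma hom_comp A B D (g : B -> D) (f : A -> B) :
  hom g -> hom f -> hom (fun x => g (f x)).
Proof.
move=> [gf gr] [ff fr]; split=> [c a|r a /fr /gr //].
by rewrite ff gf.
Qed.

Lemma emb_comp A B D (g : B -> D) (f : A -> B) :
  emb g -> emb f -> emb (fun x => g (f x)).
Proof.
move=> [gh [gi gr]] [fh [fi fr]]; split; first exact: hom_comp.
by split=> [x y /gi /fi //|r a /gr /fr].
Qed.

Lemma emb_of_comp A B D (g : B -> D) (f : A -> B) :
  hom g -> hom f -> emb (fun x => g (f x)) -> emb f.
Proof.
move=> gh fh [_ [gfi gfr]]; split=> //; split=> [x y e|r a H].
  by apply: gfi; rewrite e.
by apply: gfr; apply: gh.2 H.
Qed.

Lemma emb_inverse A B (h : A -> B) : emb h -> surj h ->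
  exists g : B -> A, [/\ emb g, forall x, g (h x) = x & forall y, h (g y) = y].
Proof.
move=> [[hf hr] [hi hrr]] /fun_choice [g hg]; exists g.
have gh x : g (h x) = x by apply: hi.
have hge (I : Type) (a : I -> B) : (fun j => h (g (a j))) = a.
  by apply: functional_extensionality => j.
split=> //; split; [split|split] => [c a|r a H|x y e|r a /hr].
- by apply: hi; rewrite hf hg hge.
- by apply: hrr; rewrite hge.
- by rewrite -(hg x) e hg.
- by rewrite hge.
Qed.

Lemma gen_subset A (s t : list A) (y : A) :
  (forall x, List.In x s -> gen t x) -> gen s y -> gen t y.
Proof. by move=> st gy; apply: gy => //; apply: gen_closed. Qed.

Lemma gen_in A (s : list A) (x : A) : List.In x s -> gen s x.
Proof. by move=> xs P _; apply. Qed.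

Lemma gen_map A B (h : A -> B) (s : list A) (x : A) :
  hom h -> gen s x -> gen (List.map h s) (h x).
Proof.
move=> [hf _] gx; apply: (gx (fun z => gen (List.map h s) (h z))) => [f a H|y ys].
  by rewrite hf; apply: gen_closed.
by apply: gen_in; apply: List.in_map.
Qed.

Lemma gen_map_image A B (h : A -> B) (s : list A) (y : B) :
  hom h -> gen (List.map h s) y -> exists2 x, gen s x & h x = y.
Proof.
move=> [hf _] gy; apply: (gy (fun z => exists2 x, gen s x & h x = z)).
  move=> f a H; have [b hb] : exists b, forall j, gen s (b j) /\ h (b j) = a j.
    apply: (fun_choice (P := fun j x => gen s x /\ h x = a j)) => j.
    by have [x] := H j; exists x.
  exists (fint A f b); first by apply: gen_closed => j; case: (hb j).
  by rewrite hf; congr fint; apply: functional_extensionality => j; case: (hb j).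
move=> z /List.in_map_iff [x [<- xs]].
by exists x => //; apply: gen_in.
Qed.

Lemma fgsub_val_emb A (s : list A) : emb (fun x : fgsub s => proj1_sig x).
Proof.
by split=> //; split=> // x y; apply: eq_sig_hprop => z p q; apply: proof_irrelevance.
Qed.

Lemma fgsub_fingen A (s : list A) : fingen (fgsub s).
Proof.
have lift (u : list A) : (forall x, List.In x u -> gen s x) ->
    exists s' : list (fgsub s), List.map (fun x => proj1_sig x) s' = u.
  elim: u => [|x u IH] H; first by exists nil.
  have [s' <-] := IH (fun x xu => H x (or_intror xu)).
  by exists (cons (exist _ x (H x (or_introl erefl))) s').
have [s' es'] := lift s (fun x => @gen_in A s x).
exists s' => y; have: gen (List.map (fun x : fgsub s => proj1_sig x) s') (proj1_sig y).
  by rewrite es'; apply: proj2_sig y.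
move=> /gen_map_image; case; first exact: emb_hom (fgsub_val_emb s).
move=> z gz e; suff <- : z = y by [].
by case: (fgsub_val_emb s) => _ [inj _]; apply: inj.
Qed.

Definition corestr A B (h : A -> B) (s : list B) (H : forall x, gen s (h x)) (x : A) : fgsub s :=
  exist _ (h x) (H x).

Lemma corestr_hom A B (h : A -> B) (s : list B) (H : forall x, gen s (h x)) :
  hom h -> hom (corestr H).
Proof.
move=> [hf hr]; split=> [f a|r a /hr //]; apply: (fgsub_val_emb s).2.1.
exact: hf.
Qed.

Lemma corestr_emb A B (h : A -> B) (s : list B) (H : forall x, gen s (h x)) :
  emb h -> emb (corestr H).
Proof.
move=> eh; apply: (emb_of_comp (g := fun x : fgsub s => proj1_sig x)) => //.
exact: corestr_hom (emb_hom eh).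
Qed.

Lemma corestr_surj A B (h : A -> B) (s : list A) (H : forall x, gen (List.map h s) (h x)) :
  hom h -> surj (corestr H).
Proof.
move=> hh [y gy]; have [x _ e] := gen_map_image hh gy; exists x.
by apply: eq_sig_hprop => // z; apply: proof_irrelevance.
Qed.

Definition incl A (s t : list A) (H : forall x, gen s x -> gen t x) : fgsub s -> fgsub t :=
  corestr (fun x : fgsub s => H _ (proj2_sig x)).

Lemma incl_emb A (s t : list A) (H : forall x, gen s x -> gen t x) : emb (incl H).
Proof. by apply/corestr_emb/fgsub_val_emb. Qed.

(** Compatibility makes the value at [x] independent of the stage containing [x]. Arities are
    finite, so every argument tuple lies in one stage, where [g n] already respects operations and
    relations. *)
Lemma glue_homs A B (t : nat -> list A) (g : forall n, fgsub (t n) -> B)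
    (mono : forall n x, gen (t n) x -> gen (t n.+1) x) :
  (forall x, exists n, gen (t n) x) -> (forall n, hom (g n)) ->
  (forall n x, g n.+1 (incl (mono n) x) = g n x) ->
  exists2 h : A -> B, hom h & forall n x, h (proj1_sig x) = g n x.
Proof.
move=> cover gh compat.
have le_gen m n x : m <= n -> gen (t m) x -> gen (t n) x.
  by move=> /subnK <-; elim: (n - m) => [//|k IH] /IH /mono.
have gE m n x (p : gen (t m) x) (q : gen (t n) x) : m <= n ->
    g m (exist _ x p) = g n (exist _ x q).
  move=> /subnK en; move: q; rewrite -{}en.
  elim: (n - m) => [|k IH] q; first by rewrite (proof_irrelevance _ p q).
  have q' : gen (t (k + m)) x by apply: (le_gen m _ x _ p); rewrite leq_addl.
  rewrite (IH q') -compat; congr (g _ _).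
  by apply: eq_sig_hprop => // z; apply: proof_irrelevance.
have [i hi] := fun_choice cover.
pose h x := g (i x) (exist _ x (hi x)).
have hE n (x : fgsub (t n)) : h (proj1_sig x) = g n x.
  case: x => x p; rewrite /h /=; case: (leqP (i x) n) => [|/ltnW] le; first exact: gE.
  by symmetry; apply: gE.
have lift k (a : 'I_k -> A) : exists n, exists b : 'I_k -> fgsub (t n),
    a = fun j => proj1_sig (b j).
  exists (\max_(j < k) i (a j)).
  have p j : gen (t (\max_(j < k) i (a j))) (a j).
    exact: le_gen (leq_bigmax (F := fun j => i (a j)) j) (hi _).
  by exists (fun j => exist _ (a j) (p j)).
exists h => //; split=> [f a|r a].
  have [n [b ->]] := lift _ a.
  have -> : (fun j => h (proj1_sig (b j))) = (fun j => g n (b j)).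
    by apply: functional_extensionality => j; rewrite hE.
  by rewrite -(gh n).1 -hE.
have [n [b ->]] := lift _ a.
have -> : (fun j => h (proj1_sig (b j))) = (fun j => g n (b j)).
  by apply: functional_extensionality => j; rewrite hE.
exact: (gh n).2.
Qed.

(** Values in [option A] allow for gaps in the numbering and for an empty [A]. *)
Lemma countable_exhaustion A : countable A ->
  exists t : nat -> option A, forall x, exists n, t n = Some x.
Proof.
move=> [c inj].
have [t ht] : exists t : nat -> option A, forall n x, c x = n -> t n = Some x.
  apply: (fun_choice (P := fun n o => forall x, c x = n -> o = Some x)) => n.
  case: (excluded_middle_informative (exists x, c x = n)) => [[x e]|H].
    by exists (Some x) => y; rewrite -e => /inj ->.
  by exists None => x e; case: H; exists x.
by exists t => x; exists (c x); apply: ht.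
Qed.

End Morphisms.

(** * Structures up to isomorphism, pushouts and injectivity *)

Section Classes.
Context {S : signature} (C : structure S -> Prop).
Implicit Types A B D T U W : structure S.

(** Finitely generated substructures are controlled by [C] only up to isomorphism. *)
Definition iso_closure A : Prop := exists2 B, C B & iso B A.

Lemma iso_closure_member A : iso_closure A ->
  exists B (f : B -> A) (g : A -> B),
    [/\ C B, emb f, emb g, forall x, g (f x) = x & forall y, f (g y) = y].
Proof.
move=> [B CB [f [ef /(emb_inverse ef) [g [eg gf fg]]]]].
by exists B, f, g.
Qed.

Lemma iso_closure_refl A : C A -> iso_closure A.
Proof.
by move=> CA; exists A => //; exists (fun x => x); split=> // y; exists y.
Qed.

Lemma iso_trans A B D : iso A B -> iso B D -> iso A D.
Proof.
move=> [f [ef sf]] [g [eg sg]]; exists (fun x => g (f x)); split; first exact: emb_comp.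
by move=> z; have [y <-] := sg z; have [x <-] := sf y; exists x.
Qed.

Lemma iso_closure_iso A B : iso_closure A -> iso A B -> iso_closure B.
Proof. by move=> [D CD DA] AB; exists D => //; apply: iso_trans AB. Qed.

Lemma inCbar_fgsub T (s : list T) : inCbar C T -> iso_closure (fgsub s).
Proof. by move=> [_ /(_ s) [A [CA AT]]]; exists A. Qed.

Lemma iso_closure_fingen A : is_age C -> iso_closure A -> fingen A.
Proof.
move=> [fg _] [B /fg [s gs] [f [ef sf]]]; exists (List.map f s) => y.
by have [x <-] := sf y; apply: gen_map (gs x); apply: emb_hom.
Qed.

Definition weak_pushout A B1 B2 (f1 : A -> B1) (f2 : A -> B2) D (g1 : B1 -> D) (g2 : B2 -> D) :=
  (forall a, g1 (f1 a) = g2 (f2 a)) /\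
  forall (E : structure S) (h1 : B1 -> E) (h2 : B2 -> E), inCbar C E -> hom h1 -> hom h2 ->
    (forall a, h1 (f1 a) = h2 (f2 a)) ->
    exists u : D -> E, [/\ hom u, forall b, u (g1 b) = h1 b & forall b, u (g2 b) = h2 b].

Definition injective_for W := forall A B (e : A -> B) (f : A -> W),
  iso_closure A -> iso_closure B -> emb e -> hom f ->
  exists2 g : B -> W, hom g & forall a, g (e a) = f a.

(** * Extension properties of the Fraïssé limit *)

Section Limit.
Variable U : structure S.
Hypotheses (strictC : strict_fraisse_class C) (limU : fraisse_limit C U) (hapC : HAP C).

Let ageC : is_age C := strictC.1.1.

Lemma limit_inCbar : inCbar C U.
Proof. by case: limU => cU [_ [aU _]]. Qed.

Lemma member_inCbar A : C A -> inCbar C A.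
Proof.
move=> CA; case: limU => [[c inj] [_ [_ /(_ A CA) [e [_ [ei _]]]]]]; split.
  by exists (fun x => c (e x)) => x y /inj /ei.
move=> s; have [_ [_ [her _]]] := ageC; exact: her.
Qed.

(* The legs of a pushout are embeddings because they factor those of an amalgam. *)
Lemma strict_weak_pushout A B1 B2 (f1 : A -> B1) (f2 : A -> B2) :
  iso_closure A -> iso_closure B1 -> iso_closure B2 -> emb f1 -> emb f2 ->
  exists D (g1 : B1 -> D) (g2 : B2 -> D), [/\ C D, emb g1, emb g2 & weak_pushout f1 f2 g1 g2].
Proof.
move=> /iso_closure_member [A' [a [a' [CA ea ea' aK aK']]]].
move=> /iso_closure_member [B1' [b1 [b1' [CB1 eb1 eb1' bK1 bK1']]]].
move=> /iso_closure_member [B2' [b2 [b2' [CB2 eb2 eb2' bK2 bK2']]]] e1 e2.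
have e1' : emb (fun x => b1' (f1 (a x))) by apply: emb_comp eb1' _; apply: emb_comp.
have e2' : emb (fun x => b2' (f2 (a x))) by apply: emb_comp eb2' _; apply: emb_comp.
have [D [g1 [g2 [CD [_ [hg1 [hg2 [com univ]]]]]]]] := strictC.2 _ _ _ _ _ CA CB1 CB2 e1' e2'.
have [E [k1 [k2 [CE [ek1 [ek2 kcom]]]]]] := strictC.1.2 _ _ _ _ _ CA CB1 CB2 e1' e2'.
have [u [hu [uk1 [uk2 _]]]] :=
  univ E k1 k2 (member_inCbar CE) (emb_hom ek1) (emb_hom ek2) kcom.
have eg1 : emb g1.
  apply: (emb_of_comp hu) => //; suff -> : (fun x => u (g1 x)) = k1 by [].
  exact: functional_extensionality.
have eg2 : emb g2.
  apply: (emb_of_comp hu) => //; suff -> : (fun x => u (g2 x)) = k2 by [].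
  exact: functional_extensionality.
exists D, (fun x => g1 (b1' x)), (fun x => g2 (b2' x)).
split=> //; [exact: emb_comp|exact: emb_comp|split=> [x|F h1 h2 cF hh1 hh2 hcom]].
  by rewrite -(aK' x) com.
have [|v [hv [v1 [v2 _]]]] := univ F (fun x => h1 (b1 x)) (fun x => h2 (b2 x)) cF
    (hom_comp hh1 (emb_hom eb1)) (hom_comp hh2 (emb_hom eb2)).
  by move=> x; rewrite bK1' bK2' hcom.
by exists v; split=> // x; rewrite (v1, v2) (bK1', bK2').
Qed.

(** A copy of [A] in [U] carries [fgsub s] to an isomorphic substructure. By homogeneity this
    isomorphism extends to an automorphism [sigma], whose inverse moves the copy so that it
    restricts to the inclusion of [fgsub s]. *)
Lemma limit_extension (s : list U) A (e : fgsub s -> A) : iso_closure A -> emb e ->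
  exists2 q : A -> U, emb q & forall x, q (e x) = proj1_sig x.
Proof.
move=> /iso_closure_member [A' [a [a' [CA ea ea' aK aK']]]] ee.
have [_ [homU [_ /(_ _ CA) [k ek]]]] := limU.
pose p x := k (a' (e x)).
have ep : emb p by apply: emb_comp ek _; apply: emb_comp.
have [s' gs] := fgsub_fingen s.
have pt x : gen (List.map p s') (p x) by apply: gen_map (gs x); apply: emb_hom.
have [sigma [esig [ssig sE]]] :=
  homU _ _ _ (corestr_emb pt ep) (corestr_surj pt (emb_hom ep)).
have [tau [etau tauK _]] := emb_inverse esig ssig.
exists (fun x => tau (k (a' x))); first by apply: emb_comp etau _; apply: emb_comp.
by move=> x; rewrite -[RHS]tauK sE.
Qed.

(** The map [f] takes values in a finitely generated substructure of [U]. HAP, applied to [e] and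
    this corestriction, yields [D] extending that substructure, and [limit_extension] embeds [D]
    into [U] over it. *)
Lemma limit_injective : injective_for U.
Proof.
move=> A B e f clA clB ee hf.
have [s gs] := iso_closure_fingen ageC clA.
have ft x : gen (List.map f s) (f x) by apply: gen_map (gs x).
have := inCbar_fgsub (List.map f s) limit_inCbar.
move=> /iso_closure_member [I [i [i' [CI ei ei' iK iK']]]].
have [A' [a [a' [CA ea ea' aK aK']]]] := iso_closure_member clA.
have [B' [b [b' [CB eb eb' bK bK']]]] := iso_closure_member clB.
have hft := corestr_hom ft hf.
have [D [g1 [g2 [CD [hg1 [eg2 com]]]]]] := hapC CA CB CI
  (emb_comp eb' (emb_comp ee ea)) (hom_comp (emb_hom ei') (hom_comp hft (emb_hom ea))).
have [q eq qE] := limit_extension (iso_closure_refl CD) (emb_comp eg2 ei').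
exists (fun x => q (g1 (b' x))).
  by apply: hom_comp (emb_hom eq) _; apply: hom_comp hg1 _; apply: emb_hom.
by move=> x; rewrite -(aK' x) com qE.
Qed.

(** A weak pushout property of the square formed by [j], [j'] and the two inclusions, tested against
    injective targets. *)
Definition extends_along T (t t' : list T) (tt' : forall x, gen t x -> gen t' x)
    (s s' : list U) (ss' : forall x, gen s x -> gen s' x)
    (j : fgsub t -> fgsub s) (j' : fgsub t' -> fgsub s') :=
  forall W (h : fgsub s -> W) (f : fgsub t' -> W), inCbar C W -> injective_for W ->
    hom h -> hom f -> (forall x, h (j x) = f (incl tt' x)) ->
    exists h' : fgsub s' -> W,
      [/\ hom h', forall x, h' (incl ss' x) = h x & forall x, h' (j' x) = f x].

Lemma extension_step T (t t' : list T) (tt' : forall x, gen t x -> gen t' x) (o : option U)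
    (s : list U) (j : fgsub t -> fgsub s) : inCbar C T -> emb j ->
  exists (s' : list U) (ss' : forall x, gen s x -> gen s' x) (j' : fgsub t' -> fgsub s'),
    [/\ emb j', forall x, j' (incl tt' x) = incl ss' (j x),
        forall x, o = Some x -> gen s' x & extends_along tt' ss' j j'].
Proof.
move=> cT ej.
have clt := inCbar_fgsub t cT; have clt' := inCbar_fgsub t' cT.
have cls := inCbar_fgsub s limit_inCbar.
have [P [p1 [p2 [CP ep1 ep2 [com univ]]]]] := strict_weak_pushout clt clt' cls (incl_emb tt') ej.
have [q eq qE] := limit_extension (iso_closure_refl CP) ep2.
have [g gg] := ageC.1 _ CP.
(* The substructure generated by [s'] contains the copy of the pushout; adding the element in [o]
   lets successive stages exhaust [U]. *)
pose s' := if o is Some x then cons x (List.map q g) else List.map q g.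
have qs' x : gen s' (q x).
  apply: gen_subset (gen_map (emb_hom eq) (gg x)) => y yg; apply: gen_in.
  by rewrite /s'; case: (o) => //; right.
have ss' x : gen s x -> gen s' x by move=> gx; have /= <- := qE (exist _ x gx).
have eqs := corestr_emb qs' eq.
exists s', ss', (fun x => corestr qs' (p1 x)); split.
- exact: emb_comp.
- move=> x; apply: eq_sig_hprop => [z|/=]; first exact: proof_irrelevance.
  by rewrite com qE.
- by move=> x ox; apply: gen_in; rewrite /s' ox; left.
move=> W h f cW iW hh hf hfE.
(* The map [u] lives on the pushout; injectivity of [W] extends it along the embedding of [P] into
   [fgsub s']. *)
have [u [hu u1 u2]] := univ W f h cW hf hh (fun x => esym (hfE x)).
have cls' := inCbar_fgsub s' limit_inCbar.
have [h' hh' h'E] := iW _ _ _ _ (iso_closure_refl CP) cls' eqs hu.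
exists h'; split=> // x; last by rewrite h'E.
rewrite -u2 -h'E; congr h'; apply: eq_sig_hprop => [z|/=]; first exact: proof_irrelevance.
by rewrite qE.
Qed.

(** * Extension of homomorphisms from countable structures *)

Lemma hom_extension T : inCbar C T ->
  exists2 j : T -> U, hom j & forall W (f : T -> W), inCbar C W -> injective_for W -> hom f ->
    exists2 F : U -> W, hom F & forall x, F (j x) = f x.
Proof.
move=> cT.
have [oT hT] := countable_exhaustion cT.1.
have [oU hU] := countable_exhaustion limit_inCbar.1.
pose t := fix t n : list T := if n is m.+1 then
  (if oT m is Some x then cons x (t m) else t m) else nil.
have tt n x : gen (t n) x -> gen (t n.+1) x.
  by apply: gen_subset => y yt; apply: gen_in => /=; case: (oT n) => //; right.
have tT x : exists n, gen (t n) x.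
  by have [n e] := hT x; exists n.+1; apply: gen_in; rewrite /= e; left.
pose St n := {s : list U & {j : fgsub (t n) -> fgsub s | emb j}}.
pose mkSt n s (j : fgsub (t n) -> fgsub s) (ej : emb j) : St n :=
  existT (fun s => {j : fgsub (t n) -> fgsub s | emb j}) s (exist _ j ej).
pose js n (x : St n) : fgsub (t n) -> fgsub (projT1 x) := proj1_sig (projT2 x).
(* The list [t 0] is empty, so the first stage embeds the substructure generated by the
   constants. *)
have [x0 _] : exists x0 : St 0, True.
  have /iso_closure_member [A [f [g [CA ef eg fK gK]]]] := inCbar_fgsub (t 0) cT.
  have [_ [_ [_ /(_ _ CA) [e ee]]]] := limU.
  have [gs gg] := fgsub_fingen (t 0).
  have ek := emb_comp ee eg.
  have H x : gen (List.map (fun x => e (g x)) gs) (e (g x)).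
    by apply: (gen_map (emb_hom ek)) (gg x).
  by exists (mkSt _ _ _ (corestr_emb H ek)).
(* The inclusion of stages is quantified inside the relation; proof irrelevance later identifies it
   with [ss]. *)
have [|x hx] := @dependent_choice St (fun n x y =>
  exists ss : forall z, gen (projT1 x) z -> gen (projT1 y) z,
  [/\ forall z, js _ y (incl (@tt n) z) = incl ss (js _ x z),
    forall z, oU n = Some z -> gen (projT1 y) z & extends_along (@tt n) ss (js _ x) (js _ y)]) x0.
  move=> n [s [j ej]].
  have [s' [ss' [j' [ej' j'E os' ext]]]] := extension_step (@tt n) (oU n) cT ej.
  by exists (mkSt _ _ _ ej'), ss'.
pose s n := projT1 (x n).
have ss n z : gen (s n) z -> gen (s n.+1) z by have [H _] := hx n; apply: H.
have sU z : exists n, gen (s n) z.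
  by have [n e] := hU z; exists n.+1; have [_ [_ H _]] := hx n; apply: H.
pose jn n := js n (x n).
have ejn n : emb (jn n) by apply: proj2_sig (projT2 (x n)).
have jnE n z : jn n.+1 (incl (@tt n) z) = incl (@ss n) (jn n z).
  by have [H [e _ _]] := hx n; rewrite /jn e (proof_irrelevance _ H (@ss n)).
have extn n : extends_along (@tt n) (@ss n) (jn n) (jn n.+1).
  by have [H [_ _]] := hx n; rewrite (proof_irrelevance _ H (@ss n)).
have [|n|n z|j hj jE] := @glue_homs S T U t (fun n z => proj1_sig (jn n z)) tt.
- exact: tT.
- exact: emb_hom (emb_comp (fgsub_val_emb (s n)) (ejn n)).
- by rewrite jnE.
exists j => // W f cW iW hf.
pose fn n (z : fgsub (t n)) := f (proj1_sig z).
have hfn n : hom (fn n) by apply: hom_comp hf _; apply: emb_hom (fgsub_val_emb (t n)).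
(* Stage [n] of the extension agrees with [f] along [jn n], which is the compatibility that [extn]
   requires to reach stage [n.+1]. *)
pose Ht n := {h : fgsub (s n) -> W | hom h /\ forall z, h (jn n z) = fn n z}.
have [h0 _] : exists h0 : Ht 0, True.
  have [h hh hE] := iW _ _ _ _ (inCbar_fgsub (t 0) cT) (inCbar_fgsub (s 0) limit_inCbar)
    (ejn 0) (hfn 0).
  by exists (exist _ h (conj hh hE)).
have [|h hE] := @dependent_choice Ht (fun n h h' =>
  forall z, proj1_sig h' (incl (@ss n) z) = proj1_sig h z) h0.
  move=> n [h [hh hE]].
  have [h' [hh' h'E h'j]] := extn n W h (fn n.+1) cW iW hh (hfn n.+1) hE.
  by exists (exist _ h' (conj hh' h'j)).
have [|n|n z|F hF FE] := @glue_homs S U W s (fun n => proj1_sig (h n)) ss.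
- exact: sU.
- exact: (proj2_sig (h n)).1.
- exact: hE.
exists F => // z; have [n gz] := tT z.
by rewrite (jE n (exist _ z gz)) FE (proj2_sig (h n)).2.
Qed.

(** * Substructures of members, and powers *)

Lemma iso_closure_sub A B (k : A -> B) : fingen A -> C B -> emb k -> iso_closure A.
Proof.
move=> [s gs] CB ek; have [_ [_ [/(_ B CB (List.map k s)) [D [CD isoD]] _]]] := ageC.
have kt x : gen (List.map k s) (k x) by apply: gen_map (gs x); apply: emb_hom.
have [l [el lK Kl]] := emb_inverse (corestr_emb kt ek) (corestr_surj kt (emb_hom ek)).
apply: (iso_closure_iso (A := fgsub (List.map k s))); first by exists D.
by exists l; split=> // x; exists (corestr kt x).
Qed.

Lemma hom_prod A I (F : I -> structure S) (f : A -> prodstr F) :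
  (forall i, hom (fun x => f x i)) -> hom f.
Proof.
move=> hf; split=> [c a|r a H i]; last exact: (hf i).2.
by apply: functional_extensionality_dep => i; apply: (hf i).1.
Qed.

Lemma hom_coord A I (F : I -> structure S) (f : A -> prodstr F) i :
  hom f -> hom (fun x => f x i).
Proof. by move=> [ff fr]; split=> [c a|r a /fr]; rewrite ?ff //; apply. Qed.

Lemma power_injective W n : injective_for W -> injective_for (power W n).
Proof.
move=> iW A B e f clA clB ee hf.
have [|g hg] := @fun_choice 'I_n (fun=> B -> W) (fun i g => hom g /\ forall a, g (e a) = f a i).
  by move=> i; have [g hg gE] := iW _ _ _ _ clA clB ee (hom_coord i hf); exists g.
exists (fun b i => g i b); first by apply: hom_prod => i; case: (hg i).
by move=> a; apply: functional_extensionality_dep => i; case: (hg i).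
Qed.

(** A finitely generated substructure of the power embeds into the product of copies in [C] of the
    substructures generated by its coordinates. That product is isomorphic to a member of [C], and
    [C] is hereditary. *)
Lemma power_inCbar W n : closed_fin_products C -> inCbar C W -> inCbar C (power W n.+1).
Proof.
move=> prodC cW; split.
  have [c inj] := cW.1; exists (fun x => pickle [ffun i => c (x i)]).
  move=> x y /(pcan_inj (@pickleK _)) /ffunP H; apply: functional_extensionality_dep => i.
  by apply: inj; have := H i; rewrite !ffunE.
move=> s; suff [A CA isoA] : iso_closure (fgsub s) by exists A.
pose si (i : 'I_n.+1) := List.map (fun x : power W n.+1 => x i) s.
have [|A hA] := @fun_choice 'I_n.+1 (fun=> structure S)
  (fun i A => C A /\ exists g : fgsub (si i) -> A, emb g).
  move=> i; have := inCbar_fgsub (si i) cW => /iso_closure_member [A [f [g [CA _ eg _ _]]]].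
  by exists A; split=> //; exists g.
have [g eg] := fun_choice (fun i => (hA i).2).
have hc i : hom (fun x : power W n.+1 => x i) by split=> [c a|r a] //; apply.
have cg i (x : fgsub s) : gen (si i) (proj1_sig x i) by apply: (gen_map (hc i) (proj2_sig x)).
pose e (x : fgsub s) : prodstr A := fun i => g i (corestr (cg i) x).
have ee : emb e.
  split; [apply: hom_prod => i|split=> [x y exy|r a H i]].
  - apply: hom_comp (emb_hom (eg i)) _; apply: corestr_hom.
    by apply: hom_comp (hc i) _; apply: emb_hom; apply: fgsub_val_emb.
  - apply: eq_sig_hprop => [z|]; first exact: proof_irrelevance.
    apply: functional_extensionality_dep => i; have := f_equal (fun z => z i) exy.
    by rewrite /e => /(eg i).2.1 [].
  - exact: (eg i).2.2 (H i).
have [B [CB [l [el sl]]]] := prodC _ A (fun i => (hA i).1).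
have [m [em _ _]] := emb_inverse el sl.
exact: iso_closure_sub (fgsub_fingen s) CB (emb_comp em ee).
Qed.

(** * Sequences of endomorphisms and a pairing operation *)

Lemma endo_sequence_fg (f : nat -> U -> U) : coproduct_omega_exists C U -> (forall k, hom (f k)) ->
  exists G : list (U -> U), (forall g, List.In g G -> hom g) /\ forall k, exists w,
    (forall g, List.In g w -> List.In g G) /\
    forall x, f k x = List.fold_right (fun g h => fun y => g (h y)) id w x.
Proof.
move=> [V [iota [cV [hi univ]]]] hf.
have [j hj jext] := hom_extension cV.
(* Here [phi] is the copairing of the sequence, [sh] moves copy [n] to copy [n.+1], and [Sh] lifts
   this shift to [U]. *)
have [phi [hphi [phiE _]]] := univ U f limit_inCbar hf.
have [sh [hsh [shE _]]] := univ V (fun n => iota n.+1) cV (fun n => hi n.+1).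
have [F hF FE] := jext U phi limit_inCbar limit_injective hphi.
have [Sh hSh ShE] := jext U _ limit_inCbar limit_injective (hom_comp hj hsh).
pose j0 x := j (iota 0 x).
exists [:: F; Sh; j0]; split=> [g /= [<-|[<-|[<-|//]]] //|k]; first exact: hom_comp.
exists (F :: nseq k Sh ++ [:: j0]); split=> [g /= [<-|gw]|x /=]; first by left.
  elim: k gw => [|k IH] /= [<-|gw]; [by right; right; left|by case: gw|by right; left|exact: IH].
(* Applying [Sh] [k] times to [j0 x] moves it from copy 0 to copy [k], where [F] acts as [f k]. *)
suff -> : List.fold_right (fun g h => fun y => g (h y)) id (nseq k Sh ++ [:: j0]) x = j (iota k x).
  by rewrite FE phiE.
by elim: k => [//|k IH] /=; rewrite IH ShE shE.
Qed.

Lemma pairing_retraction : closed_fin_products C ->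
  exists (p : power U 2 -> U) (r : U -> power U 2), [/\ hom p, hom r & forall x, r (p x) = x].
Proof.
move=> prodC; have cU2 := power_inCbar 1 prodC limit_inCbar.
have [p hp pext] := hom_extension cU2.
have [r hr rE] := pext _ (fun x => x) cU2 (power_injective (n := 2) limit_injective) (@hom_id _ _).
by exists p, r.
Qed.

End Limit.
End Classes.

(** * Terms and generated clones *)

Section Clones.
Variable X : Type.
Implicit Types Cl : opset X.

Local Notation operation := {n : nat & ('I_n.+1 -> X) -> X}.

Section Terms.
Variable F : list operation.

(** Indices out of range denote the unary identity, so that every tree can be evaluated. *)
Let op k : operation := List.nth k F (existT _ 0 (fun x => x ord0)).

(** Terms are encoded in [GenTree.tree nat] because that type is countable: leaves are variables,
    nodes index operations, and missing arguments are read as [v 0]. *)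
Fixpoint term_eval (t : GenTree.tree nat) (v : nat -> X) : X :=
  match t with
  | GenTree.Leaf i => v i
  | GenTree.Node k ts => projT2 (op k) (fun i => nth (v 0) (map (fun t => term_eval t v) ts) i)
  end.

Lemma term_eval_mkseq k (a : nat -> GenTree.tree nat) v :
  term_eval (GenTree.Node k (mkseq a (projT1 (op k)).+1)) v =
    projT2 (op k) (fun i => term_eval (a i) v).
Proof.
congr (projT2 (op k) _); apply: functional_extensionality => i.
by rewrite (nth_map (a 0)) ?size_mkseq // nth_mkseq.
Qed.

Lemma term_subst (t : GenTree.tree nat) (sigma : nat -> GenTree.tree nat) :
  exists t', forall v, term_eval t' v = term_eval t (fun i => term_eval (sigma i) v).
Proof.
elim: t => [i|k ts H]; first by exists (sigma i).
have [ts' [sz tsE]] : exists ts', size ts' = size ts /\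
    forall v, map (fun t => term_eval t v) ts' =
      map (fun t => term_eval t (fun i => term_eval (sigma i) v)) ts.
  elim: ts H => [|t ts IH] /=; first by exists nil.
  move=> [[t' t'E] /IH [ts' [sz tsE]]]; exists (t' :: ts') => /=; split; first by rewrite sz.
  by move=> v; rewrite t'E tsE.
(* Arguments are padded with [sigma 0], since under the substitution the default [v 0] becomes the
   value of [sigma 0]. *)
exists (GenTree.Node k (mkseq (nth (sigma 0) ts') (projT1 (op k)).+1)) => v.
rewrite term_eval_mkseq [RHS]/=; congr (projT2 (op k) _); apply: functional_extensionality => i.
rewrite -tsE.
case: (ltnP i (size ts')) => szi; first by rewrite (nth_map (sigma 0)).
by rewrite !nth_default ?size_map.
Qed.

(** The operations represented by terms form a clone containing [F], hence one of the clones that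
    [clone_gen F] intersects. *)
Lemma clone_gen_term n f : clone_gen F f ->
  exists t, forall x : 'I_n.+1 -> X, f x = term_eval t (fun i => x (inord i)).
Proof.
move=> /(_ (fun n f => exists t, forall x : 'I_n.+1 -> X,
  f x = term_eval t (fun i => x (inord i)))); apply=> {n f}.
  split=> [n i|n m f g [t tE] /fun_choice [tg tgE]].
    by exists (GenTree.Leaf (i : nat)) => x /=; rewrite inord_val.
  have [t' t'E] := term_subst t (fun i => tg (inord i)); exists t' => x.
  rewrite t'E tE; congr term_eval; apply: functional_extensionality => i; exact: tgE.
move=> p pF; have [k [_ <-]] := List.In_nth F p (existT _ 0 (fun x => x ord0)) pF.
rewrite -/(op k); exists (GenTree.Node k (mkseq (@GenTree.Leaf nat) (projT1 (op k)).+1)) => x.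
by rewrite term_eval_mkseq; congr (projT2 (op k) _); apply: functional_extensionality => i /=;
  rewrite inord_val.
Qed.

End Terms.
Lemma clone_comp_unary Cl n (g : X -> X) (f : ('I_n.+1 -> X) -> X) : is_clone Cl ->
  Cl 0 (fun x => g (x ord0)) -> Cl n f -> Cl n (fun x => g (f x)).
Proof.
by move=> [_ comp] Cg Cf; apply: (comp 0 n (fun x => g (x ord0)) (fun=> f)).
Qed.

Lemma clone_fold Cl (w : list (X -> X)) : is_clone Cl ->
  (forall g, List.In g w -> Cl 0 (fun x => g (x ord0))) ->
  Cl 0 (fun x => List.fold_right (fun g h => fun y => g (h y)) id w (x ord0)).
Proof.
move=> clC; elim: w => [|g w IH] /= H; first exact: clC.1.
apply: (clone_comp_unary (f := fun x => _ w (x ord0)) clC); first by apply: H; left.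
by apply: IH => h hw; apply: H; right.
Qed.

End Clones.

(* Right-nested iteration of a pairing operation encodes tuples of every positive length. *)
Lemma power_code (S : signature) (U : structure S) (p : power U 2 -> U) (r : U -> power U 2) n :
  hom r -> (forall x, r (p x) = x) ->
  exists (q : power U n.+1 -> U) (d : U -> power U n.+1),
    [/\ hom d, forall x, d (q x) = x &
      forall Cl : opset U, is_clone Cl -> Cl 1 p -> Cl n q].
Proof.
move=> hr rK; elim: n => [|n [q [d [hd dK qCl]]]].
  exists (fun x => x ord0), (fun u _ => u); split=> [|x|Cl [proj _] _]; last exact: proj.
    by apply: hom_prod => i; apply: hom_id.
  by apply: functional_extensionality_dep => i; rewrite ord1.
pose i1 : 'I_2 := lift ord0 ord0.
pose arg (i : 'I_2) (x : power U n.+2) : U :=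
  if i == ord0 then x ord0 else q (fun j => x (lift ord0 j)).
exists (fun x => p (fun i => arg i x)).
exists (fun u i => if unlift ord0 i is Some j then d (r u i1) j else r u ord0); split.
- apply: hom_prod => i; case: (unlift ord0 i) => [j|].
    by apply: hom_comp (hom_coord j hd) (hom_coord i1 hr).
  exact: hom_coord ord0 hr.
- move=> x; apply: functional_extensionality_dep => i; rewrite rK.
  case: unliftP => [j|] -> //; by rewrite /arg /= dK.
move=> Cl clC Cp; apply: (clC.2 _ _ _ _ Cp) => i.
rewrite /arg; case: (i == ord0); first exact: clC.1.
by apply: (clC.2 _ _ q (fun j x => x (lift ord0 j))) => [|j]; [exact: qCl|exact: clC.1].
Qed.

(** * Uncountable cofinality of the polymorphism clone *)

Theorem theorem6p3 (S : signature) (C : structure S -> Prop) (U : structure S) :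
  strict_fraisse_class C ->
  fraisse_limit C U ->
  closed_fin_products C ->
  HAP C ->
  coproduct_omega_exists C U ->
  ~ End_fg U ->
  uncountable_cofinality (Pol U).
Proof.
move=> strictC limU prodC hapC coprodU not_fg.
have seq_fg f := @endo_sequence_fg _ _ _ strictC limU hapC f coprodU.
have [p [r [hp hr rK]]] := pairing_retraction strictC limU hapC prodC.
have endo_Pol (e : U -> U) : hom e -> Pol U 0 (fun x : 'I_1 -> U => e (x ord0)).
  by move=> he; apply: hom_comp he _; split=> [c a|s a] //; apply.
have Pol_gen (Cl : opset U) : is_clone Cl -> Cl 1 p ->
    (forall e, hom e -> Cl 0 (fun x => e (x ord0))) -> opsubset (Pol U) Cl.
  (* Every [f] factors through the code [q], which is built from [p], followed by the endomorphism
     [f] after [d]. *)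
  move=> clC Cp Ce n f hf; have [q [d [hd dK qCl]]] := power_code n hr rK.
  have -> : f = fun x => f (d (q x)) by apply: functional_extensionality => x; rewrite dK.
  apply: (clone_comp_unary (g := fun u => f (d u))) => //; last exact: qCl.
  by apply: (Ce (fun u => f (d u))); apply: hom_comp hf hd.
split=> [[F [_ genF]]|[Ch [clCh [subCh [properCh [monoCh unionCh]]]]]].
  apply: not_fg.
  (* Take for [f k] the endomorphism represented by the term with code [k], or the identity if there
     is none. Every endomorphism has a term, so [f] enumerates [End U]. *)
  have [|f hf] := @fun_choice nat (fun=> U -> U) (fun k f => hom f /\
      forall e t, hom e -> pickle t = k ->
        (forall x : 'I_1 -> U, e (x ord0) = term_eval F t (fun i => x (inord i))) -> f = e).
    move=> k.
    case: (excluded_middle_informative (exists e t, hom e /\ pickle t = k /\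
      forall x : 'I_1 -> U, e (x ord0) = term_eval F t (fun i => x (inord i)))).
      move=> [e [t [he [<- etE]]]]; exists e; split=> // e' t' _.
      move=> /(pcan_inj (@pickleK _)) -> e'tE; apply: functional_extensionality => y.
      by rewrite (etE (fun=> y)) (e'tE (fun=> y)).
    move=> H; exists id; split=> [|e t he tk etE]; first exact: hom_id.
    by case: H; exists e, t.
  have [G [hG Gf]] := seq_fg f (fun k => (hf k).1).
  exists G; split=> // e he.
  have [t et] := clone_gen_term (genF _ _ (endo_Pol e he)).
  by have := Gf (pickle t); rewrite ((hf _).2 e t he erefl et).
have Ch_le m n : m <= n -> opsubset (Ch m) (Ch n).
  by move=> /subnK <-; elim: (n - m) => [//|k IH] l f /IH /monoCh.
have [k0 Chp] := unionCh 1 p hp.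
(* From [k0] on the clones contain [p], so by [Pol_gen] each of these proper subclones omits an
   endomorphism. *)
have [|f hf] := @fun_choice nat (fun=> U -> U) (fun k f => hom f /\
    ~ Ch (maxn k0 k) 0 (fun x => f (x ord0))).
  move=> k; apply: NNPP => H; have [n [g [Pg]]] := properCh (maxn k0 k); apply.
  apply: Pol_gen Pg => //; first exact: Ch_le (leq_maxl _ _) _ _ Chp.
  by move=> e he; apply: NNPP => Ce; apply: H; exists e.
have [G [hG Gf]] := seq_fg f (fun k => (hf k).1).
have [k Gk] : exists k, forall g, List.In g G -> Ch k 0 (fun x => g (x ord0)).
  elim: G {Gf} hG => [|g G IH] hG; first by exists 0.
  have [k Gk] := IH (fun h hh => hG h (or_intror hh)).
  have [l gl] := unionCh _ _ (endo_Pol g (hG g (or_introl erefl))).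
  exists (maxn k l) => h /= [<-|/Gk]; first exact: Ch_le (leq_maxr _ _) _ _ gl.
  exact: Ch_le (leq_maxl _ _) _ _.
(* The finite list [G] lies in [Ch k], so the word for [f k] puts it in [Ch (maxn k0 k)], contrary
   to its choice. *)
have [w [wG fE]] := Gf k; case: (hf k) => _; apply.
apply: Ch_le (leq_maxr _ _) _ _ _.
have -> : f k = List.fold_right (fun g h => fun y => g (h y)) id w.
  by apply: functional_extensionality.
by apply: clone_fold => // g /wG /Gk.
Qed.
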